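(* There exist absolute constants $K > 0$ and $\Delta_0 \in \mathbb{N}$ such that for every integer $\Delta \geq \Delta_0$ and every $n$-vertex triangle-free graph $G$ of maximum degree at most $\Delta$, $$c(G,\Delta+1) \,\geq\, \left(\frac{\Delta}{\sqrt{e}} - K\right)^n.$$
   Context: All graphs are finite, undirected, and simple. For a graph $G$ and a positive integer $q$, $c(G,q)$ denotes the number of proper $q$-colorings of $G$, i.e., of maps $f \colon V(G) \to \{1,\ldots,q\}$ with $f(u)\neq f(v)$ whenever $uv \in E(G)$. Here $e$ is the base of the natural logarithm. *)

(* Defs.v *)
From mathcomp Require Import all_boot.

Set Implicit Arguments.
Unset Strict Implicit.
Unset Printing Implicit Defensive.

Local Open Scope nat_scope.

                                                                      
                                                   

Definition simple_graph (V : finType) (adj : rel V) : Prop :=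
  symmetric adj /\ irreflexive adj.

Definition degree (V : finType) (adj : rel V) (v : V) : nat :=
  #|[set u | adj v u]|.

Definition max_degree (V : finType) (adj : rel V) : nat :=
  \max_(v : V) degree adj v.

Definition triangle_free (V : finType) (adj : rel V) : Prop :=
  ~ exists u v w : V, [/\ adj u v, adj v w & adj u w].

Definition proper_coloring (V : finType) (adj : rel V) (q : nat)
    (f : {ffun V -> 'I_q}) : bool :=
  [forall u, forall v, adj u v ==> (f u != f v)].

Definition num_colorings (V : finType) (adj : rel V) (q : nat) : nat :=
  #|[set f : {ffun V -> 'I_q} | proper_coloring adj f]|.

(* Main.v *)
Require Import Defs.
From HB Require Import structures.
From mathcomp Require Import all_boot all_order all_algebra.
From mathcomp Require Import all_classical all_reals all_analysis.
From mathcomp Require Import ring lra zify.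

Set Implicit Arguments.
Unset Strict Implicit.
Unset Printing Implicit Defensive.

Import Order.TTheory GRing.Theory Num.Theory.

Local Open Scope ring_scope.

(** Write q = Delta + 1, and let N(A) be the number of maps V -> 'I_q that are
    proper on the subset A of V and arbitrary elsewhere, so that N(set0) = q^n
    and N(V) = c(G, q).  Vertices are added to A one at a time; the ratio
    N(A + v) / N(A) is the probability that in a uniform f proper on A the free
    color f(v) avoids the colors of S, the neighbors of v in A.

    Lower bound on the ratio.  S is independent because G is triangle-free, so,
    once f is known outside S, the colors of S are independent, each u in S
    being uniform on its set L_u of free colors, of size l_u.  Hence the ratio
    is the mean of the product over u in S of 1 - [f(v) in L_u] / l_u
    (num_proper_onU1).  As u has the neighbor v outside A, l_u >= 2, and the
    factor is at least exp(- [f(v) in L_u] (1/l_u) (1 + 2/l_u)).  By Jensen's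
    inequality the mean of the product is at least the exponential of the mean
    exponent; and since f(v) is uniform, [f(v) in L_u] averages to l_u / q.  The
    ratio is thus at least exp(- (1/q) sum_(u in S) (1 + 2 E[1/l_u])).

    Controlling E[1/l_u].  Weighting by 1/l_u exactly undoes the choice of a
    color for u, so E[1/l_u] is at most N(A - u) / (q N(A)) (sum_inv_free),
    which is again the inverse of a ratio.  So the crude bound that all
    ratios are at least 1/16 is self-improving: it gives E[1/l_u] <= 16/q, hence
    a ratio of at least exp(- (|S|/q) (1 + 32/q)) (num_proper_extend), and this
    is at least exp(-2) >= 1/16 as soon as q >= 32 (num_proper_ratio).

    Multiplying the ratios, the |S| add up to the number of edges, at most
    n q / 2, so that c(G, q) >= (q exp(- 1/2 - 16/q))^n, and
    q exp(- 16/q) >= q - 16. *)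

(** * Elementary identities and inequalities *)

Lemma sum_neq (R : pzRingType) (T : finType) (L : {set T}) (x : T) :
  \sum_(c in L) (x != c)%:R = #|L|%:R - (x \in L)%:R :> R.
Proof.
rewrite (cardsD1 x) natrD addrAC subrr add0r -sum1_card natr_sum.
rewrite big_mkcond [RHS]big_mkcond; apply: eq_bigr => c _.
by rewrite !inE eq_sym; case: eqP; case: (c \in L).
Qed.

(** With x = 1/l <= 1/2 this follows from (1 - x) (1 + x + 2 x^2) >= 1 and
    exp y >= 1 + y at y = x + 2 x^2.  The term x is exact to first order, as
    the factor 1 / sqrt e requires; the constant 2 only affects K and Delta0. *)
Lemma expR_le_1BV (R : realType) (l : nat) : (2 <= l)%N ->
  expR (- (l%:R^-1 * (1 + 2 * l%:R^-1))) <= 1 - l%:R^-1 :> R.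
Proof.
move=> l2; have l2R : (2 : R) <= l%:R by rewrite ler_nat.
set x : R := l%:R^-1.
have x0 : 0 < x by rewrite invr_gt0; lra.
have xh : x <= 1 / 2.
  by rewrite div1r lef_pV2 // posrE; lra.
set y := x * (1 + 2 * x).
have y0 : 0 < y by rewrite /y; nra.
have ey : 1 + y <= expR y := expR_ge1Dx y.
rewrite expRN -[leLHS]mulr1 ler_pdivrMl ?expR_gt0 //.
have : 1 <= (1 + y) * (1 - x) by rewrite /y; nra.
move/le_trans; apply; rewrite ler_wpM2r //; lra.
Qed.

(** Jensen's inequality for exp, by summing its tangent line at m.  The form
    without division stays valid when P is empty. *)
Lemma jensen_expR (R : realType) (I : finType) (P : pred I) (X : I -> R) m :
    #|P|%:R * m <= \sum_(i | P i) X i ->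
  #|P|%:R * expR m <= \sum_(i | P i) expR (X i).
Proof.
move=> mX; apply: (@le_trans _ _ (\sum_(i | P i) expR m * (1 + (X i - m)))).
  rewrite -mulr_sumr mulrC ler_wpM2l ?expR_ge0 // big_split /= sumrB !sumr_const.
  by rewrite -[m *+ _]mulr_natl lerDl subr_ge0.
apply: ler_sum => i _.
have := expR_ge1Dx (X i - m); have := expR_gt0 m.
by rewrite expRB -ler_pdivlMl ?expR_gt0 // mulrC.
Qed.

(** * Resampling the color of one vertex *)

Section Recoloring.
Variables (V : finType) (q : nat).
Implicit Types (f : {ffun V -> 'I_q}) (u w : V) (c : 'I_q).

Definition recolor f u c : {ffun V -> 'I_q} :=
  [ffun w => if w == u then c else f w].

Lemma recolor_same f u c : recolor f u c u = c.
Proof. by rewrite ffunE eqxx. Qed.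

Lemma recolor_other f u c w : w != u -> recolor f u c w = f w.
Proof. by rewrite ffunE => /negbTE ->. Qed.

Lemma recolorK f u c : recolor (recolor f u c) u (f u) = f.
Proof. by apply/ffunP => w; rewrite !ffunE; case: eqP => // ->. Qed.

Lemma recolor_id f u : recolor f u (f u) = f.
Proof. by apply/ffunP => w; rewrite !ffunE; case: eqP => // ->. Qed.

Lemma recolor_recolor f u c c' : recolor (recolor f u c) u c' = recolor f u c'.
Proof. by apply/ffunP => w; rewrite !ffunE; case: eqP. Qed.

(** The involution (f, c) |-> (recolor f u c, f u) preserves the set of pairs
    with P f and c in L f.  It exchanges the two members, once the left one is
    written as the sum of F f / #|L f| over these pairs: the uniform measure on
    P is stationary for redrawing the color of u. *)
Lemma resampling (R : numFieldType) (P : pred {ffun V -> 'I_q}) u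
    (L : {ffun V -> 'I_q} -> {set 'I_q}) (F : {ffun V -> 'I_q} -> R) :
    (forall f c, P f -> P (recolor f u c) = (c \in L f)) ->
  \sum_(f | P f) F f =
  \sum_(f | P f) #|L f|%:R^-1 * \sum_(c in L f) F (recolor f u c).
Proof.
move=> PL.
have Lrec f c : P f -> c \in L f -> L (recolor f u c) = L f.
  move=> Pf cL; apply/setP => c'.
  by rewrite -PL ?(PL f c) // recolor_recolor PL.
have Lself f : P f -> f u \in L f by move=> Pf; rewrite -PL // recolor_id.
under [RHS]eq_bigr do rewrite mulr_sumr.
rewrite pair_big_dep /=.
pose h (p : {ffun V -> 'I_q} * 'I_q) := (recolor p.1 u p.2, p.1 u).
have hK : involutive h.
  by case=> f c; rewrite /h /= recolorK recolor_same.
rewrite (reindex_inj (inv_inj hK)) /=.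
rewrite [RHS](eq_bigl (fun p => P p.1 && (p.2 \in L p.1))) => [|p]; last first.
  apply/andP/andP => [[Pr ur]|[Pf cL]].
    have Pf : P p.1.
      by rewrite -(recolorK p.1 u p.2) PL.
    by rewrite -PL.
  by rewrite PL // cL Lrec // Lself.
rewrite -(pair_big_dep P (fun f c => c \in L f)
  (fun f c => #|L (recolor f u c)|%:R^-1 * F (recolor (recolor f u c) u (f u)))) /=.
apply: eq_bigr => f Pf.
under eq_bigr => c cL do rewrite Lrec // recolorK.
rewrite sumr_const -[_ *+ _]mulr_natl mulrA divff ?mul1r //.
by rewrite pnatr_eq0 -lt0n; apply/card_gt0P; exists (f u); exact: Lself.
Qed.

End Recoloring.

(** * Maps that are proper on a set of vertices *)

Section Colorings.
Variables (R : realType) (V : finType) (adj : rel V) (q : nat).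
Implicit Types (f : {ffun V -> 'I_q}) (u v w : V) (c : 'I_q) (A : {set V}).

Definition proper_on A f : bool :=
  [forall u in A, forall w in A, adj u w ==> (f u != f w)].

(** Defined from the graph rather than as the set of c such that recolor f u c
    is proper on A: in this form it ignores the colors of all non-neighbors
    of u, also when these make f improper. *)
Definition free_colors A u f : {set 'I_q} :=
  [set c | [forall w in A, adj u w ==> (f w != c)]].

Definition nbrs A u : {set V} := [set w in A | adj u w].

(** Vertices outside A keep a free color, so that all the sets A are compared
    on the same space of maps: for the subgraph G[A] induced by A, this is
    c(G[A], q) * q ^ (#|V| - #|A|). *)
Definition num_proper_on A : R := #|proper_on A|%:R.

Hypotheses (adj_sym : symmetric adj) (adj_irr : irreflexive adj).

Lemma proper_onP A f :
  reflect (forall u w, u \in A -> w \in A -> adj u w -> f u != f w)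
          (proper_on A f).
Proof.
apply: (iffP forall_inP) => [H u w uA wA|H u uA].
  by move: (forall_inP (H u uA) w wA) => /implyP.
by apply/forall_inP => w wA; apply/implyP; apply: H.
Qed.

Lemma free_colorsP A u f c :
  reflect (forall w, w \in A -> adj u w -> f w != c) (c \in free_colors A u f).
Proof.
rewrite inE; apply: (iffP forall_inP) => H w wA; first exact/implyP/H.
exact/implyP/H.
Qed.

Lemma free_colors_recolor A u w f c : ~~ adj u w || (w \notin A) ->
  free_colors A u (recolor f w c) = free_colors A u f.
Proof.
move=> uw; apply/setP => c'.
suff E x : x \in A -> adj u x -> recolor f w c x = f x.
  by apply/free_colorsP/free_colorsP => H x xA ux; move: (H x xA ux); rewrite E.
move=> xA ux; rewrite recolor_other //; apply: contraTneq uw => <-.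
by rewrite ux xA.
Qed.

Lemma proper_recolor_in A u f c : u \in A -> proper_on A f ->
  proper_on A (recolor f u c) = (c \in free_colors A u f).
Proof.
move=> uA /proper_onP Pf; apply/proper_onP/free_colorsP => H.
  move=> w wA uw; have := H u w uA wA uw; rewrite recolor_same.
  rewrite recolor_other 1?eq_sym //.
  by apply: contraTneq uw => ->; rewrite adj_irr.
move=> x y xA yA xy; rewrite !ffunE.
case: (x =P u) => [xu|_]; case: (y =P u) => [yu|_].
- by move: xy; rewrite xu yu adj_irr.
- by rewrite eq_sym H // -xu.
- by rewrite H // -yu adj_sym.
- exact: Pf.
Qed.

Lemma proper_recolor_out A u f c : u \notin A ->
  proper_on A (recolor f u c) = proper_on A f.
Proof.
move=> uA; suff E x : x \in A -> recolor f u c x = f x.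
  by apply/proper_onP/proper_onP => H x y xA yA xy; move: (H x y xA yA xy);
     rewrite !E.
by move=> xA; rewrite recolor_other //; apply: contraNneq uA => <-.
Qed.

Lemma proper_onU1 A v f : v \notin A ->
  proper_on (v |: A) f = proper_on A f && (f v \in free_colors A v f).
Proof.
move=> vA; apply/proper_onP/andP => [H|[/proper_onP Pf /free_colorsP H] x y].
  split; first by apply/proper_onP => x y xA yA; apply: H; rewrite !inE ?xA ?yA orbT.
  apply/free_colorsP => w wA vw; rewrite eq_sym H // !inE ?eqxx //.
  by rewrite wA orbT.
rewrite !inE => /orP[/eqP->|xA] /orP[/eqP->|yA].
- by rewrite adj_irr.
- by move=> vy; rewrite eq_sym H.
- by rewrite adj_sym => vx; rewrite H.
- exact: Pf.
Qed.

Lemma sum_proper_const A (x : R) :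
  \sum_(f | proper_on A f) x = num_proper_on A * x.
Proof.
by rewrite sumr_const mulr_natl.
Qed.

Lemma card_free_gt0 A u f : u \in A -> proper_on A f ->
  (0 < #|free_colors A u f|)%N.
Proof.
move=> uA Pf; apply/card_gt0P; exists (f u).
by rewrite -proper_recolor_in // recolor_id.
Qed.

Lemma card_free_ge A u f : (q <= #|free_colors A u f| + #|nbrs A u|)%N.
Proof.
rewrite -[X in (X <= _)%N](card_ord q) -(cardsC (free_colors A u f)) leq_add2l.
apply: leq_trans (leq_imset_card f (mem (nbrs A u))).
apply/subset_leq_card/fintype.subsetP => c; rewrite inE.
apply: contraR => H; apply/free_colorsP => w wA uw.
by apply: contraNneq H => <-; apply: imset_f; rewrite inE wA.
Qed.

(** The vertices of s are resampled one after the other.  Resampling u turns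
    [f v != f u] into its mean over the free colors of u, and leaves all the
    other factors unchanged, because u is adjacent to no vertex of s.  The
    weight G is there for the induction, to carry the factors of the vertices
    that are still to be resampled. *)
Lemma sum_resampled_factors A v (s : seq V) (G : {ffun V -> 'I_q} -> R) :
    v \notin A -> uniq s -> {subset s <= A} -> {in s &, forall u w, ~~ adj u w} ->
    (forall f u c, u \in s -> G (recolor f u c) = G f) ->
  \sum_(f | proper_on A f) G f * \prod_(u <- s) (f v != f u)%:R =
  \sum_(f | proper_on A f) G f *
    \prod_(u <- s) (1 - (f v \in free_colors A u f)%:R / #|free_colors A u f|%:R).
Proof.
move=> vA; elim: s G => [|u s IH] G /=.
  by move=> *; apply: eq_bigr => f _; rewrite !big_nil.
move=> /andP[us Us] sA indep Ginv.
have uA : u \in A by apply: sA; rewrite mem_head.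
have vNu : v != u by apply: contraNneq vA => ->.
under eq_bigr do rewrite big_cons mulrA.
rewrite (IH (fun f => G f * (f v != f u)%:R)) //; first last.
- move=> f w c ws.
  have vw : v != w.
    by apply: contraNneq vA => ->; apply: sA; rewrite inE ws orbT.
  have uw : u != w by apply: contraNneq us => ->.
  by rewrite Ginv ?inE ?ws ?orbT // !recolor_other.
- by move=> x y xs ys; apply: indep; rewrite inE ?xs ?ys orbT.
- by move=> x xs; apply: sA; rewrite inE xs orbT.
(* H collects what does not depend on the color of u; only its defining
   equation is kept, so that rewriting does not see through it *)
have [H HE] : exists H : {ffun V -> 'I_q} -> R, forall f, H f = G f *
    \prod_(w <- s) (1 - (f v \in free_colors A w f)%:R / #|free_colors A w f|%:R).
  by eexists=> f; reflexivity.
have Hinv f c : H (recolor f u c) = H f.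
  rewrite !HE Ginv ?mem_head //; congr (_ * _); apply: eq_big_seq => w ws.
  rewrite recolor_other // free_colors_recolor // indep ?mem_head //.
  by rewrite inE ws orbT.
transitivity (\sum_(f | proper_on A f) H f * (f v != f u)%:R).
  by apply: eq_bigr => f _; rewrite HE mulrAC.
rewrite (resampling _ (fun f c => proper_recolor_in c uA)).
apply: eq_bigr => f Pf; rewrite big_cons mulrCA -HE.
under eq_bigr => c _ do rewrite Hinv recolor_other // recolor_same.
rewrite -mulr_sumr mulrCA [in RHS]mulrC; congr (_ * _).
set L := free_colors A u f.
have Lgt0 : (#|L|%:R : R) != 0 by rewrite pnatr_eq0 -lt0n card_free_gt0.
rewrite sum_neq.
by rewrite mulrBr mulVf // mulrC.
Qed.

Lemma free_colorsU1 A u f : free_colors (u |: A) u f = free_colors A u f.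
Proof.
apply/setP => c; apply/free_colorsP/free_colorsP => H w wA uw.
  by apply: H; rewrite // inE wA orbT.
apply: H => //; move: wA; rewrite !inE => /orP[/eqP wu|//].
by move: uw; rewrite wu adj_irr.
Qed.

Lemma resampling_free A v (F : {ffun V -> 'I_q} -> R) : v \notin A ->
  \sum_(f | proper_on A f) F f =
  \sum_(f | proper_on A f) q%:R^-1 * \sum_c F (recolor f v c).
Proof.
move=> vA; rewrite (@resampling _ _ _ _ v (fun=> [set: 'I_q])).
  apply: eq_bigr => f _; rewrite cardsT card_ord; congr (_ * _).
  by apply: eq_bigl => c; rewrite inE.
by move=> f c Pf; rewrite proper_recolor_out // Pf inE.
Qed.

(** A map proper on A extends to u by #|free_colors A u f| colors, so giving
    each extension the weight 1 / #|free_colors A u f| counts each map at most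
    once (not at all if it has no extension).  This expresses the mean of
    1 / #|free_colors| through the ratio of two consecutive counts. *)
Lemma sum_inv_free A u : u \notin A ->
  \sum_(f | proper_on (u |: A) f) (#|free_colors (u |: A) u f|%:R)^-1
    <= num_proper_on A / q%:R.
Proof.
move=> uA; under eq_bigl do rewrite proper_onU1 //.
rewrite big_mkcondr /= (resampling_free _ uA) -sum_proper_const.
apply: ler_sum => f Pf; rewrite ler_piMr ?invr_ge0 //.
rewrite -big_mkcond /=.
under eq_bigl do rewrite recolor_same free_colors_recolor ?uA ?orbT //.
under eq_bigr do rewrite free_colorsU1 free_colors_recolor ?uA ?orbT //.
rewrite sumr_const -[_ *+ _]mulr_natl.
by case: eqP (@mulfV R #|free_colors A u f|%:R) => [->|_ ->]; rewrite ?mul0r.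
Qed.

Hypothesis no_triangle : triangle_free adj.

(** Absence of triangles enters here only, through the independence of the
    neighborhood of v. *)
Lemma num_proper_onU1 A v : v \notin A ->
  num_proper_on (v |: A) =
  \sum_(f | proper_on A f) \prod_(u in nbrs A v)
    (1 - (f v \in free_colors A u f)%:R / #|free_colors A u f|%:R).
Proof.
move=> vA; have := sum_proper_const (v |: A) 1; rewrite mulr1 => <-.
under eq_bigl do rewrite proper_onU1 //.
rewrite big_mkcondr /=.
have sA : {subset enum (nbrs A v) <= A}.
  by move=> u; rewrite mem_enum inE => /andP[].
have indep : {in enum (nbrs A v) &, forall u w, ~~ adj u w}.
  move=> u w; rewrite !mem_enum !inE => /andP[_ vu] /andP[_ vw].
  by apply/negP => uw; apply: no_triangle; exists v, u, w.
transitivity (\sum_(f | proper_on A f)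
    1 * \prod_(u <- enum (nbrs A v)) (f v != f u)%:R : R); last first.
  rewrite (sum_resampled_factors (G := fun=> 1) vA (enum_uniq _) sA indep) //.
  by apply: eq_bigr => f _; rewrite mul1r big_enum.
apply: eq_bigr => f _; rewrite mul1r big_enum /=.
case: ifPn => [/free_colorsP H|H].
  rewrite big1 // => u; rewrite inE => /andP[uA vu].
  by rewrite eq_sym H.
apply/esym/eqP; rewrite prodf_seq_eq0; apply/hasP.
move: H; rewrite inE => /forall_inPn[w wA]; rewrite negb_imply negbK.
move=> /andP[vw /eqP fw]; exists w; first by rewrite mem_index_enum.
by rewrite inE wA vw fw eqxx /= eqxx.
Qed.



(** * The ratio of consecutive counts *)

Hypotheses (q_ge32 : (32 <= q)%N) (deg_lt : forall u, (degree adj u < q)%N).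

(** Since v is a neighbor of u outside A, at most q - 2 neighbors of u lie
    in A. *)
Lemma card_free_ge2 A u v f : v \notin A -> adj u v ->
  (2 <= #|free_colors A u f|)%N.
Proof.
move=> vA uv.
have : (#|nbrs A u| < degree adj u)%N.
  apply: proper_card; apply/properP; split.
    by apply/fintype.subsetP => w; rewrite !inE => /andP[].
  by exists v; rewrite inE ?uv // (negbTE vA).
move: (card_free_ge A u f) (deg_lt u); lia.
Qed.

(** The hypothesis is the crude ratio bound for the sets A - u; it gives that
    1 / #|free_colors A u f| has mean at most 16 / q, whence 32 = 2 * 16. *)
Lemma num_proper_extend A v : v \notin A ->
    (forall u, u \in A -> num_proper_on (A :\ u) <= 16 * num_proper_on A) ->
  num_proper_on A * expR (- (#|nbrs A v|%:R / q%:R * (1 + 32 / q%:R)))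
    <= num_proper_on (v |: A).
Proof.
move=> vA IH; rewrite num_proper_onU1 //.
have q0 : 0 < q%:R :> R by rewrite ltr0n; lia.
pose y f u : R := #|free_colors A u f|%:R^-1 * (1 + 2 * #|free_colors A u f|%:R^-1).
pose X f : R := \sum_(u in nbrs A v) - ((f v \in free_colors A u f)%:R * y f u).
apply: (@le_trans _ _ (\sum_(f | proper_on A f) expR (X f))); last first.
  apply: ler_sum => f Pf; rewrite expR_sum; apply: ler_prod => u.
  rewrite inE => /andP[uA vu]; rewrite expR_ge0 /=.
  case: (f v \in _); last by rewrite !mul0r oppr0 expR0 addr0.
  rewrite !mul1r; apply: expR_le_1BV; apply: (card_free_ge2 f vA).
  by rewrite adj_sym.
apply: jensen_expR.
rewrite exchange_big /=.
have nbr_avg u : u \in nbrs A v ->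
    \sum_(f | proper_on A f) (f v \in free_colors A u f)%:R * y f u <=
    num_proper_on A / q%:R * (1 + 32 / q%:R).
  rewrite inE => /andP[uA vu].
  rewrite (resampling_free _ vA).
  have inv_avg : \sum_(f | proper_on A f) (#|free_colors A u f|%:R)^-1
      <= 16 * num_proper_on A / q%:R.
    have := @sum_inv_free (A :\ u) u; rewrite finset.setD1K // !inE eqxx => /(_ isT).
    by move/le_trans; apply; rewrite ler_pM2r ?invr_gt0 // IH.
  apply: (@le_trans _ _ (\sum_(f | proper_on A f)
     q%:R^-1 * (1 + 2 * #|free_colors A u f|%:R^-1))).
    apply: ler_sum => f Pf; rewrite ler_pM2l ?invr_gt0 //.
    under eq_bigr do rewrite recolor_same /y free_colors_recolor ?vA ?orbT //.
    rewrite -mulr_suml -natr_sum -big_mkcond /= sum1_card mulrA divff ?mul1r //.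
    by rewrite pnatr_eq0 -lt0n card_free_gt0.
  rewrite -mulr_sumr big_split /= -mulr_sumr sum_proper_const mulr1.
  rewrite [num_proper_on A / _]mulrC -mulrA ler_pM2l ?invr_gt0 // mulrDr mulr1 lerD2l.
  have -> : num_proper_on A * (32 / q%:R) = 2 * (16 * num_proper_on A / q%:R).
    by field; rewrite gt_eqF.
  by rewrite ler_pM2l.
under eq_bigr do rewrite sumrN.
rewrite sumrN mulrN lerN2; apply: le_trans (ler_sum _ nbr_avg) _.
rewrite sumr_const -[_ *+ _]mulr_natl -/(num_proper_on A).
lra.
Qed.

(** The constant 16 reproduces itself: the exponent of the previous lemma is at
    least - (1 + 32/q) >= -2, and exp(-2) >= (1 - 1/2)^4 = 1/16. *)
Lemma num_proper_ratio A v : v \notin A ->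
  num_proper_on A <= 16 * num_proper_on (v |: A).
Proof.
have [n] := ubnP #|A|; elim: n A v => // n IHn A v ltAn vA.
have IH u : u \in A -> num_proper_on (A :\ u) <= 16 * num_proper_on A.
  move=> uA; rewrite -[in leRHS](finset.setD1K uA); apply: IHn; last by rewrite !inE eqxx.
  by move: ltAn; rewrite (cardsD1 u A) uA; lia.
have := num_proper_extend vA IH.
have q0 : 32 <= q%:R :> R by rewrite ler_nat.
have d0 : #|nbrs A v|%:R <= q%:R :> R.
  rewrite ler_nat (leq_trans _ (ltnW (deg_lt v))) //; apply/subset_leq_card.
  by apply/fintype.subsetP => w; rewrite !inE => /andP[].
have e2 : 1 / 16 <= expR (-2) :> R.
  have := expR_ge1Dx (- (1 / 2) : R).
  (* exp y >= 1 + y is only used at y = - 1/2, since at - 2 it is void *)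
  have -> : (-2 : R) = 4%:R * - (1 / 2) by lra.
  rewrite expRM_natl; set e := expR _ => eh.
  have : (1 / 2) ^+ 4 <= e ^+ 4 by rewrite lerXn2r ?nnegrE; lra.
  by apply: le_trans; rewrite (_ : (1 / 2) ^+ 4 = 1 / 16) //; field.
have : expR (-2) <= expR (- (#|nbrs A v|%:R / q%:R * (1 + 32 / q%:R))) :> R.
  rewrite ler_expR lerN2 [leRHS](_ : 2 = 1 * (1 + 1)); last by rewrite mul1r.
  apply: ler_pM; rewrite ?addr_ge0 ?divr_ge0 ?ler0n //.
    by rewrite ler_pdivrMr ?mul1r //; lra.
  by rewrite lerD2l ler_pdivrMr ?mul1r //; lra.
have : 0 <= num_proper_on A by rewrite ler0n.
set e := expR (- (_ * _)) => N0 e2e Ne.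
have : num_proper_on A * (1 / 16) <= num_proper_on A * e.
  by rewrite ler_wpM2l // (le_trans e2).
lra.
Qed.

(** The sum of the degrees in A is twice the number of edges in A, which grows
    by #|nbrs A v| when v is added. *)
Lemma num_proper_ge A :
  q%:R ^+ #|V| * expR (- ((\sum_(u in A) #|nbrs A u|)%:R / 2 / q%:R * (1 + 32 / q%:R)))
    <= num_proper_on A.
Proof.
have [n] := ubnP #|A|; elim: n A => // n IHn A ltAn.
have [->|[v vA]] := set_0Vmem A.
  rewrite big_set0 !mul0r oppr0 expR0 mulr1 -natrX ler_nat.
  rewrite -[X in (X ^ _)%N](card_ord q) -card_ffun; apply: subset_leq_card.
  by apply/fintype.subsetP => f _; apply/proper_onP => u w; rewrite inE.
have vA' : v \notin A :\ v by rewrite !inE eqxx.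
have IH : (#|A :\ v| < n)%N by move: ltAn; rewrite (cardsD1 v A) vA; lia.
have := num_proper_extend vA'.
rewrite finset.setD1K // => H; apply: le_trans (H _); last first.
  move=> u uA; rewrite -[in leRHS](finset.setD1K uA); apply: num_proper_ratio.
  by rewrite !inE eqxx.
apply: le_trans (ler_wpM2r (expR_ge0 _) (IHn _ IH)).
rewrite -[leRHS]mulrA -expRD ler_wpM2l ?exprn_ge0 ?ler0n //.
suff -> : (\sum_(u in A) #|nbrs A u| =
    \sum_(u in A :\ v) #|nbrs (A :\ v) u| + 2 * #|nbrs (A :\ v) v|)%N.
  by rewrite ler_expR natrD natrM; lra.
have E u : #|nbrs A u| = (adj u v + #|nbrs (A :\ v) u|)%N.
  rewrite (cardsD1 v) inE vA; congr (_ + _)%N; apply: eq_card => w.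
  by rewrite !inE andbA.
rewrite (bigD1 v) //= E adj_irr add0n.
rewrite (eq_bigl (mem (A :\ v))); last by move=> u; rewrite !inE andbC.
under eq_bigr do rewrite E.
rewrite big_split /=.
have -> : (\sum_(u in A :\ v) adj u v = #|nbrs (A :\ v) v|)%N.
  rewrite -sum1_card big_mkcond [RHS]big_mkcond; apply: eq_bigr => u _.
  by rewrite !inE [adj v u]adj_sym; case: (_ && _); case: adj.
lia.
Qed.

End Colorings.

(** * Triangle-free graphs of bounded degree *)

Theorem corollary1p6 (R : realType) :
  exists (K : R) (Delta0 : nat), 0 < K /\
    forall Delta : nat, (Delta0 <= Delta)%N ->
    forall (V : finType) (adj : rel V),
      simple_graph adj -> triangle_free adj -> (max_degree adj <= Delta)%N ->
      (Delta%:R / Num.sqrt (expR 1) - K) ^+ #|V|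
        <= (num_colorings adj Delta.+1)%:R.
Proof.
(* 64 makes the base of the power nonnegative: exp(- 1/2) >= 1/2 *)
exists 32, 64%N; split=> // D D64 V adj [adj_sym adj_irr] tf maxdeg.
have deg_lt u : (degree adj u < D.+1)%N.
  by rewrite ltnS (leq_trans _ maxdeg) // leq_bigmax.
have q32 : (32 <= D.+1)%N by lia.
have := num_proper_ge R adj_sym adj_irr tf q32 deg_lt [set: V].
have -> : num_proper_on R adj D.+1 [set: V] = (num_colorings adj D.+1)%:R.
  congr (_%:R); apply: eq_card => f; rewrite [RHS]inE.
  apply/proper_onP/forallP => [H u|H u w _ _ uw].
    by apply/forallP => w; apply/implyP => uw; apply: H; rewrite ?inE.
  by have /forallP/(_ w)/implyP := H u; apply.
apply: le_trans.
set q : R := D.+1%:R.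
have Dq : D%:R = q - 1 :> R by rewrite /q -natr1; lra.
have q0 : 65 <= q by rewrite ler_nat.
have [q_gt0 q_ge0] : 0 < q /\ 0 <= q by split; lra.
have sqrt_e : (Num.sqrt (expR 1))^-1 = expR (- (1 / 2)) :> R.
  rewrite -[X in expR X](_ : (2%:R * (1 / 2)) = 1); last by lra.
  by rewrite expRM_natl sqrtr_sqr ger0_norm ?expR_ge0 // expRN.
have eh : 1 / 2 <= expR (- (1 / 2)) :> R.
  by have := expR_ge1Dx (- (1 / 2) : R); lra.
have eh1 : expR (- (1 / 2)) <= 1 :> R by rewrite expR_le1; lra.
apply: (@le_trans _ _ ((q * expR (- (1 / 2) - 16 / q)) ^+ #|V|)); last first.
  rewrite exprMn -expRM_natl ler_wpM2l ?exprn_ge0 //.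
  rewrite ler_expR.
  set m := (\sum_(u in _) _)%:R.
  have mV : m <= #|V|%:R * q.
    rewrite -natrM ler_nat -[#|V|]cardsT -sum_nat_const; apply: leq_sum => u _.
    rewrite ltnW // (leq_ltn_trans _ (deg_lt u)) //; apply: subset_leq_card.
    by apply/fintype.subsetP => w; rewrite !inE.
  have -> : #|V|%:R * (- (1 / 2) - 16 / q) =
      - (#|V|%:R * q / 2 / q * (1 + 32 / q)).
    by field; rewrite gt_eqF //; lra.
  rewrite lerN2 ler_pM2r ?addr_gt0 ?divr_gt0 //.
  by rewrite !ler_pM2r ?invr_gt0.
have eD : q - 16 <= q * expR (- (16 / q)).
  rewrite (_ : q - 16 = q * (1 + - (16 / q))) ?ler_pM2l ?expR_ge1Dx //.
  by field; rewrite gt_eqF.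
rewrite sqrt_e Dq expRD lerXn2r ?nnegrE ?mulr_ge0 ?expR_ge0 //; nra.
Qed.
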